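(* There is a universal constant $c>0$ such that for every GNPC space $X$, every $p\in X$ and every $0<\delta<c$, there exists $r_0=r_0(p,\delta)>0$ such that $p$ is a $(1,\delta)$-strainer at every point of $B(p,r_0)\setminus\{p\}$.
   Context: A shortest path is an isometric embedding of a closed interval into a metric space. A complete geodesic space $(Y,d)$ is BNPC if for any two constant-speed reparametrized shortest paths $\gamma,\eta:[0,1]\to Y$, the function $t\mapsto d(\gamma(t),\eta(t))$ is convex on $[0,1]$. A metric space is locally BNPC if every point has a neighborhood that is BNPC with respect to the ambient metric. A geodesic is a curve whose restriction to each sufficiently small subinterval is a shortest path; a space is locally geodesically complete if every geodesic $\gamma:[a,b]\to X$ extends to a geodesic on $[a-\varepsilon,b+\varepsilon]$ for some $\varepsilon>0$. A GNPC space is a separable, locally compact, locally geodesically complete, locally BNPC metric space. A tiny ball in a GNPC space is an open metric ball $B$ of some radius $r$ such that the concentric closed ball of radius $10r$ is a compact BNPC space; shortest paths between points of $B$ are unique, and every sufficiently small ball around a given point is a tiny ball. $B(p,r)$ is the open metric ball. Write $|ab|=d(a,b)$. Let $B$ be a tiny ball, $p\in B$, $q\in B\setminus\{p\}$, $x\in B\setminus\{q\}$, and let $x(t)$ be the unit-speed shortest path from $q$ to $x$. The angle viewed from $p$ at $q$ toward $x$ is $\angle pqx:=\lim_{t\to0}\tilde\angle pqx(t)$, where $\tilde\angle pqx(t)$ is the angle, at the vertex corresponding to $q$, of the Euclidean triangle with side lengths $|pq|$, $|px(t)|$, $|qx(t)|$ (the limit exists and $\cos\angle pqx=-\frac{d}{dt}\big|_{t=0^+}d(p,x(t))$).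 A point $p\in B$ is a $(1,\delta)$-strainer at $x\in B$ if there are $\bar p\in B$ and a neighborhood $U\subset B$ of $x$ with $p,\bar p\notin U$ such that $\angle py\bar p>\pi-\delta$ for all $y\in U$. (Being a $(1,\delta)$-strainer at $x\in X$ means this for some tiny ball $B$ containing the points.) *)

(* Defs.v *)
From HB Require Import structures.
From mathcomp Require Import all_boot all_order all_algebra.
From mathcomp Require Import all_classical all_reals all_analysis.

Set Implicit Arguments.
Unset Strict Implicit.
Unset Printing Implicit Defensive.

Import Order.TTheory GRing.Theory Num.Theory.
Import numFieldNormedType.Exports.

Local Open Scope classical_set_scope.
Local Open Scope ring_scope.

(* Curves are total functions R -> X of which only the restriction to the
   interval under consideration is meaningful. A subset A of X stands for the
   metric space obtained by restricting the distance of X to A. *)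

Section definitions.
Context {R : realType} {X : metricType R}.

(* Degenerate intervals (a = b) are allowed, so that a point is joined to
   itself by a shortest path. *)
Definition shortest_path (a b : R) (gamma : R -> X) : Prop :=
  a <= b /\ {in `[a, b] &, forall s t, mdist (gamma s) (gamma t) = `|s - t|}.

Definition const_speed_shortest_path (gamma : R -> X) : Prop :=
  exists a b (sigma : R -> X), shortest_path a b sigma /\
    {in `[0, 1], forall t, gamma t = sigma (line_path a b t)}.

Definition complete_set (A : set X) : Prop :=
  forall F : set_system X, ProperFilter F -> F A -> cauchy F ->
  exists2 x, A x & F --> x.

Definition geodesic_set (A : set X) : Prop :=
  forall x y, A x -> A y -> exists a b (gamma : R -> X),
    [/\ shortest_path a b gamma, gamma @` `[a, b] `<=` A,
        gamma a = x & gamma b = y].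

Definition BNPC (A : set X) : Prop :=
  [/\ complete_set A, geodesic_set A &
      forall gamma eta : R -> X,
        const_speed_shortest_path gamma -> gamma @` `[0, 1] `<=` A ->
        const_speed_shortest_path eta -> eta @` `[0, 1] `<=` A ->
        @convex_function R R^o `[0, 1]%classic
          (fun t => mdist (gamma t) (eta t))].

(* On a compact interval, "each sufficiently small subinterval" can be read
   uniformly, by a Lebesgue number argument. *)
Definition geodesic (a b : R) (gamma : R -> X) : Prop :=
  exists2 e : R, 0 < e &
    forall s t, a <= s -> s <= t -> t <= b -> t - s < e ->
      shortest_path s t gamma.

Definition mclosed_ball (x : X) (r : R) : set X := [set y | mdist x y <= r].

Definition tiny_ball (B : set X) : Prop :=
  exists o (r : R), [/\ 0 < r, B = ball o r,
    compact (mclosed_ball o (10 * r)) & BNPC (mclosed_ball o (10 * r))].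

(* The angle opposite to the side c in the Euclidean triangle with side
   lengths a, b, c (law of cosines). *)
Definition euclidean_angle (a b c : R) : R :=
  acos ((a ^+ 2 + b ^+ 2 - c ^+ 2) / (2 * a * b)).

Definition comparison_angle (p q x : X) : R :=
  euclidean_angle (mdist p q) (mdist q x) (mdist p x).

(* A unit-speed shortest path from q to x parametrized by [0, |qx|]; it is
   unique on this interval when q and x lie in a common tiny ball. *)
Definition path_from_to (q x : X) : R -> X :=
  xget (fun=> q) [set gamma : R -> X |
    [/\ shortest_path 0 (mdist q x) gamma, gamma 0 = q &
        gamma (mdist q x) = x]].

Definition angle (p q x : X) : R :=
  lim (comparison_angle p q (path_from_to q x t) @[t --> 0^'+]).

Definition strainer1_in (B : set X) (delta : R) (p x : X) : Prop :=
  [/\ B p, B x &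
    exists pbar (U : set X),
      [/\ B pbar, nbhs x U, U `<=` B, ~ U p /\ ~ U pbar &
          forall y, U y -> angle p y pbar > pi - delta]].

Definition strainer1 (delta : R) (p x : X) : Prop :=
  exists2 B, tiny_ball B & strainer1_in B delta p x.

End definitions.

Section spaces.
Context {R : realType}.

Definition separable (X : topologicalType) : Prop :=
  exists2 D : set X, countable D & dense D.

Definition locally_geodesically_complete (X : metricType R) : Prop :=
  forall (a b : R) (gamma : R -> X), a < b -> geodesic a b gamma ->
  exists2 e : R, 0 < e & exists2 gamma' : R -> X,
    geodesic (a - e) (b + e) gamma' &
    {in `[a, b], forall t, gamma' t = gamma t}.

Definition locally_BNPC (X : metricType R) : Prop :=
  forall x : X, exists2 N, nbhs x N & BNPC N.

Definition GNPC (X : metricType R) : Prop :=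
  [/\ separable X, locally_compact [set: X],
      locally_geodesically_complete X & locally_BNPC X].

End spaces.

(* Main.v *)
Require Import Defs.
From mathcomp Require Import all_boot all_order all_algebra.
From mathcomp Require Import all_classical all_reals all_analysis.
From mathcomp Require Import ring lra.
Import Order.TTheory GRing.Theory Num.Theory.
Import numFieldNormedType.Exports.
Local Open Scope classical_set_scope.
Local Open Scope ring_scope.

(** Write [|uv|] for the distance of [u] and [v]. By the first variation
    formula, the angle at [y] between [p] and [a] exceeds [pi - delta] as soon
    as the right derivative at [y] of the distance to [p], along the shortest
    path towards [a], exceeds [cos delta]. That function is convex, also
    along a shortest path that continues beyond [y]; so the derivative is at
    least the slope [(|py| - |pz|) / |yz|] for any [z] lying beyond [y] on a
    prolongation of [ay] ([angle_gt]). It remains to choose [a] such that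
    every [y] near [x] has such a [z] with [|pz|] small compared to [|px|]:
    then [|yz|] and [|py| - |pz|] are both nearly [|px|], and the slope is
    nearly 1.

    Fix a compact BNPC ball around [p] and a radius [rho], and let [x] be at a
    tiny distance [s] from [p]. Prolong [px] to a point [a] with [|pa| = rho].
    Given [y] close to [x], prolong [ay] beyond [y] by a fixed amount to [w];
    both are possible by geodesic completeness, because local geodesics in a
    BNPC set are shortest paths ([BNPC_geodesic_shortest],
    [shortest_path_extend]). The path [ayw] misses [p] by at most about [s],
    so by compactness it is close to a shortest path [a'w'] passing exactly
    through [p], the errors [|aa'|] and [|ww'|] being as small as desired when
    [s] is small ([almost_between]). Nothing says that these errors are small
    compared to [s], but convexity contracts them: at distance of order [s]
    from [p], two paths issuing from nearly the same point and ending [eps]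
    apart at distance of order [rho] are only [s * eps / rho] apart. This is
    applied once on each side of [p]: first from [p] towards [a] and [a'],
    placing [x], hence [y], close to the path [a'w']; then from [y] back
    towards [w] and [w'], which yields the point [z] that corresponds to [p]
    ([shortest_path_passes_near]). *)

(** * Shortest paths and convexity of the distance *)

Section paths.
Context {R : realType} {X : metricType R}.
Implicit Types (x y z m : X) (A : set X) (a b s t l : R).

Lemma mdist_cvg (T : Type) (F : set_system T) (FF : Filter F) (f g : T -> X)
    x y :
  f @ F --> x -> g @ F --> y -> mdist (f t) (g t) @[t --> F] --> mdist x y.
Proof.
move=> fx gy; apply/cvgrPdist_lt => e e0.
have e2 : 0 < e / 2 by rewrite divr_gt0.
have Hf := metricType_numDomainType.cvgr_dist_lt fx e2.
have Hg := metricType_numDomainType.cvgr_dist_lt gy e2.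
near=> t.
have hf : mdist x (f t) < e / 2 by near: t; exact: Hf.
have hg : mdist y (g t) < e / 2 by near: t; exact: Hg.
have := metric_triangle x (f t) y; have := metric_triangle (f t) (g t) y.
have := metric_triangle (f t) x (g t); have := metric_triangle x y (g t).
rewrite [mdist (g t) y]metric_sym [mdist (f t) x]metric_sym => h1 h2 h3 h4.
by rewrite ltr_norml; apply/andP; split; lra.
Unshelve. all: by end_near. Qed.

Lemma mdist_continuous x : continuous (mdist x).
Proof. by move=> y; apply: mdist_cvg; [exact: cvg_cst|exact: cvg_id]. Qed.

Lemma mclosed_ball_closed x t : closed (mclosed_ball x t).
Proof.
rewrite (_ : mclosed_ball x t = mdist x @^-1` [set s | s <= t]) //.
by apply: closed_comp (@closed_le _ t) => y _; exact: mdist_continuous.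
Qed.

(** A map that does not expand distances is isometric as soon as it does not
    shorten the distance of the endpoints: a loss in the middle could not be
    made up for. *)
Lemma shortest_pathP a b (g : R -> X) : a <= b ->
  (forall s t, a <= s -> s <= t -> t <= b -> mdist (g s) (g t) <= t - s) ->
  b - a <= mdist (g a) (g b) -> shortest_path a b g.
Proof.
move=> ab lip gab; split=> // s t.
rewrite !in_itv/= => /andP[as_ sb] /andP[at_ tb].
wlog st : s t as_ sb at_ tb / s <= t.
  move=> h; have [/h->//|/ltW ts] := leP s t.
  by rewrite metric_sym distrC; exact: h.
rewrite ler0_norm ?subr_le0// opprB; apply/eqP; rewrite eq_le lip//=.
have := lip a s (lexx _) as_ sb; have := lip t b at_ tb (lexx _).
have := metric_triangle (g a) (g s) (g b).
have := metric_triangle (g s) (g t) (g b); lra.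
Qed.

Lemma shortest_path_dist a b (g : R -> X) s t : shortest_path a b g ->
  a <= s -> s <= t -> t <= b -> mdist (g s) (g t) = t - s.
Proof.
move=> [_ h] as_ st tb; rewrite h ?in_itv/= ?as_ ?tb ?(le_trans st)//.
  by rewrite ler0_norm ?opprB// subr_le0.
by rewrite (le_trans as_).
Qed.

Lemma shortest_path_from0 A x y : geodesic_set A -> A x -> A y ->
  exists g : R -> X, [/\ shortest_path 0 (mdist x y) g,
    forall t, 0 <= t <= mdist x y -> A (g t), g 0 = x & g (mdist x y) = y].
Proof.
move=> gA Ax Ay; have [a [b [g [sg sub ga gb]]]] := gA _ _ Ax Ay.
have ab := sg.1; have dxy : mdist x y = b - a.
  by rewrite -ga -gb (shortest_path_dist _ _ _ _ _ sg).
exists (fun t => g (t + a)); split.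
- apply: shortest_pathP.
  + exact: mdist_ge0.
  + move=> s t s0 st tb; rewrite (shortest_path_dist _ _ _ _ _ sg); lra.
  + by rewrite add0r dxy subrK ga gb dxy; lra.
- by move=> t ?; apply: sub; exists (t + a) => //=; rewrite in_itv/=; lra.
- by rewrite add0r.
- by rewrite dxy subrK.
Qed.

Lemma shortest_path_through A x m y : geodesic_set A -> A x -> A m -> A y ->
  mdist x m + mdist m y = mdist x y ->
  exists g : R -> X, [/\ shortest_path 0 (mdist x y) g,
    forall t, 0 <= t <= mdist x y -> A (g t), g 0 = x, g (mdist x m) = m &
    g (mdist x y) = y].
Proof.
move=> gA Ax Am Ay xmy.
have [g [sg Ag g0 g1]] := shortest_path_from0 _ _ _ gA Ax Am.
have [h [sh Ah h0 h1]] := shortest_path_from0 _ _ _ gA Am Ay.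
have xm0 := mdist_ge0 x m; have my0 := mdist_ge0 m y.
pose k t := if t <= mdist x m then g t else h (t - mdist x m).
have kh t : mdist x m <= t -> k t = h (t - mdist x m).
  by rewrite /k; case: ltgtP => // <- _; rewrite subrr h0 g1.
have kg t : t <= mdist x m -> k t = g t by rewrite /k => ->.
have ky : k (mdist x y) = y.
  have e : mdist x y - mdist x m = mdist m y by lra.
  by rewrite kh ?e//; lra.
exists k; split.
- apply: shortest_pathP.
  + exact: mdist_ge0.
  + move=> s t s0 st ty; have [tm|mt] := leP t (mdist x m).
      rewrite !kg ?(le_trans st)// (shortest_path_dist _ _ _ _ _ sg)//.
    have [ms|sm] := leP (mdist x m) s.
      rewrite !kh ?(ltW mt)// (shortest_path_dist _ _ _ _ _ sh); lra.
    rewrite kg ?(ltW sm)// kh ?(ltW mt)//.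
    apply: le_trans (metric_triangle _ m _) _.
    rewrite -{1}g1 -{2}h0 (shortest_path_dist _ _ _ _ _ sg) ?(ltW sm)//.
    rewrite (shortest_path_dist _ _ _ _ _ sh); lra.
  + rewrite kg// g0 ky; lra.
- move=> t /andP[t0 ty]; rewrite /k; case: ifPn => tm.
    by apply: Ag; rewrite t0.
  by apply: Ah; rewrite -ltNge in tm; lra.
- by rewrite kg.
- by rewrite kg.
- exact: ky.
Qed.

Lemma between_exists A x y t : geodesic_set A -> A x -> A y ->
  0 <= t <= mdist x y ->
  exists m, [/\ A m, mdist x m = t & mdist m y = mdist x y - t].
Proof.
move=> gA Ax Ay /andP[t0 ty].
have [g [sg Ag g0 g1]] := shortest_path_from0 _ _ _ gA Ax Ay.
exists (g t); split; first by apply: Ag; rewrite t0.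
  by rewrite -{1}g0 (shortest_path_dist _ _ _ _ _ sg)//; lra.
by rewrite -{1}g1 (shortest_path_dist _ _ _ _ _ sg)//; lra.
Qed.

(** The form in which convexity is used throughout: the curves are replaced by
    the points dividing them in the ratio [l], so that all later arguments can
    be carried out with distances alone. *)
Lemma BNPC_between A l x m y x' m' y' : BNPC A -> 0 <= l <= 1 ->
  A x -> A m -> A y -> A x' -> A m' -> A y' ->
  mdist x m = l * mdist x y -> mdist m y = (1 - l) * mdist x y ->
  mdist x' m' = l * mdist x' y' -> mdist m' y' = (1 - l) * mdist x' y' ->
  mdist m m' <= (1 - l) * mdist x x' + l * mdist y y'.
Proof.
move=> [_ gA cA] l01 Ax Am Ay Ax' Am' Ay' xm my xm' my'.
have P z n w : A z -> A n -> A w -> mdist z n = l * mdist z w ->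
    mdist n w = (1 - l) * mdist z w -> exists g : R -> X,
    [/\ const_speed_shortest_path g, g @` `[0, 1] `<=` A, g 0 = z, g l = n &
        g 1 = w].
  move=> Az An Aw zn nw.
  have [|g [sg Ag g0 gl g1]] := shortest_path_through _ _ _ _ gA Az An Aw.
    by rewrite zn nw; lra.
  exists (fun t => g (t * mdist z w)); split.
  - exists 0, (mdist z w), g; split=> // t _.
    by rewrite /line_path mulr0 add0r mulrC.
  - move=> _ [t + <-]; rewrite /= in_itv/= => /andP[t0 t1]; apply: Ag.
    by rewrite mulr_ge0 ?mdist_ge0//= ler_piMl ?mdist_ge0.
  - by rewrite mul0r.
  - by rewrite -zn.
  - by rewrite mul1r.
have [g [sg Ag g0 gl g1]] := P _ _ _ Ax Am Ay xm my.
have [h [sh Ah h0 hl h1]] := P _ _ _ Ax' Am' Ay' xm' my'.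
have [l0 l1] := andP l01.
have := cA g h sg Ag sh Ah (Itv01 l0 l1) 1 0.
rewrite !inE/= !in_itv/= ler01 !lexx => /(_ isT isT).
rewrite /conv/= /GRing.scale/= !mulr1 !mulr0 !addr0.
rewrite gl hl g0 h0 g1 h1 [conv _ _ _]convR_line_path /line_path /=; lra.
Qed.

End paths.

(** * Local geodesics and their prolongation *)

(** As [f 0 <= 0], the ratios [f k / k] do not decrease with [k]; hence a
    positive value at [k] would propagate to all later indices, up to [n]. *)
Lemma midpoint_convex_le0 (R : realFieldType) (n : nat) (f : nat -> R) :
  f 0%N <= 0 -> f n <= 0 ->
  (forall k, (k.+1 < n)%N -> 2 * f k.+1 <= f k + f k.+2) ->
  forall k, (k <= n)%N -> f k <= 0.
Proof.
move=> f0 fn conv_f.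
have slope k : (k < n)%N -> k.+1%:R * f k <= k%:R * f k.+1.
  elim: k => [|k IH] kn; first by rewrite mul1r mul0r.
  have := IH (ltnW kn); have := conv_f _ kn.
  have k0 : 0 <= k%:R :> R by [].
  have -> : k.+2%:R = k%:R + 2 :> R by rewrite -addn2 natrD.
  have -> : k.+1%:R = k%:R + 1 :> R by rewrite -addn1 natrD.
  nra.
have pos k : (k < n)%N -> 0 < f k -> 0 < f k.+1.
  case: k => [|k] kn fk; first by have := f0; rewrite leNgt fk.
  have /(lt_le_trans _) := slope _ kn.
  by move/(_ 0); rewrite !pmulr_rgt0//; exact.
move=> k kn; rewrite leNgt; apply/negP => fk.
suff : 0 < f n by rewrite ltNge fn.
rewrite -(subnKC kn); have : (k + (n - k) <= n)%N by rewrite subnKC.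
elim: (n - k)%N => [|j IH]; first by rewrite addn0.
by rewrite addnS => jn; apply: pos => //; apply: IH; exact: ltnW.
Qed.

Section geodesics.
Context {R : realType} {X : metricType R}.
Implicit Types (x y z m : X) (A : set X) (s t l : R).

Lemma geodesic_lipschitz a b (g : R -> X) s t : geodesic a b g ->
  a <= s -> s <= t -> t <= b -> mdist (g s) (g t) <= t - s.
Proof.
move=> [e e0 ge] as_ st tb.
have e2 : 0 < e / 2 by rewrite divr_gt0.
have [n] : exists n : nat, t - s <= n%:R * (e / 2).
  exists (Num.bound ((t - s) / (e / 2))).
  rewrite -ler_pdivrMr// ltW// archi_boundP// divr_ge0// ?(ltW e2)//; lra.
elim: n s as_ st => [|n IH] s as_ st sn.
  have -> : s = t by lra.
  by rewrite mdistxx subrr.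
have [h|h] := leP t (s + e / 2).
  by rewrite (shortest_path_dist _ _ _ _ _ (ge s t as_ st tb _)); lra.
apply: le_trans (metric_triangle _ (g (s + e / 2)) _) _.
have ss : mdist (g s) (g (s + e / 2)) = s + e / 2 - s.
  by apply: (shortest_path_dist _ _ _ _ _ (ge s (s + e / 2) _ _ _ _)); lra.
have := IH (s + e / 2); rewrite -addn1 natrD in sn; move=> /(_ _ _ _) H.
have : mdist (g (s + e / 2)) (g t) <= t - (s + e / 2) by apply: H; lra.
lra.
Qed.

(** Compare [g] with a shortest path [u] having the same endpoints, at
    equidistant parameters so fine that any three consecutive points of [g] lie
    on one of its shortest pieces. By convexity the distance between
    corresponding points is then midpoint convex, and it vanishes at both
    ends; so it vanishes everywhere. Already the first step shows that [u] has
    the speed of [g], that is, its length is [b - a]. *)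
Lemma BNPC_geodesic_shortest A a b (g : R -> X) : BNPC A -> a <= b ->
  (forall t, a <= t <= b -> A (g t)) -> geodesic a b g -> shortest_path a b g.
Proof.
move=> bA ab Ag geo; apply: shortest_pathP => //.
  by move=> s t; exact: geodesic_lipschitz.
have [e e0 ge] := geo.
have [n0 hn] : exists n : nat, (0 < n)%N /\ b - a < n%:R * (e / 2).
  have e2 : 0 < e / 2 by rewrite divr_gt0.
  have ba : 0 <= (b - a) / (e / 2) by rewrite divr_ge0// ?(ltW e2)//; lra.
  have := archi_boundP ba; set n := Num.bound _ => hn.
  by exists n; split; [|rewrite -ltr_pdivrMr].
case: n0 hn => [[]//|n [_ hn]].
pose N : R := n.+1%:R; have N0 : 0 < N by rewrite ltr0n.
pose h := (b - a) / N; pose D := mdist (g a) (g b); pose H := D / N.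
have hN : N * h = b - a by rewrite /h mulrCA divff ?mulr1// gt_eqF.
have HN : N * H = D by rewrite /H mulrCA divff ?mulr1// gt_eqF.
have h0 : 0 <= h by rewrite divr_ge0// ?(ltW N0)//; lra.
have H0 : 0 <= H by rewrite divr_ge0// ?(ltW N0)// mdist_ge0.
have he : h < e / 2 by rewrite /h ltr_pdivrMr// mulrC.
have kN (k : nat) : (k <= n.+1)%N -> k%:R <= N by move=> ?; rewrite ler_nat.
have k0 (k : nat) : 0 <= k%:R :> R by [].
have kh (k : nat) : (k <= n.+1)%N -> a <= a + k%:R * h <= b.
  by move=> /kN kn; have := k0 k; nra.
have kH (k : nat) : (k <= n.+1)%N -> 0 <= k%:R * H <= D.
  by move=> /kN kn; have := k0 k; nra.
have [_ gA _] := bA.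
have Aa : A (g a) by apply: Ag; rewrite lexx.
have Ab : A (g b) by apply: Ag; rewrite lexx ab.
have [u [su Au u0 u1]] := shortest_path_from0 _ _ _ gA Aa Ab.
pose f (k : nat) := mdist (g (a + k%:R * h)) (u (k%:R * H)).
have f0 : forall k, (k <= n.+1)%N -> f k <= 0.
  apply: midpoint_convex_le0.
  - by rewrite /f !mul0r addr0 u0 mdistxx.
  - by rewrite /f hN HN u1 addrC subrK mdistxx.
  move=> k kn.
  have := kh _ (ltnW (ltnW kn)); have := kh _ (ltnW kn); have := kh _ kn.
  have := kH _ (ltnW (ltnW kn)); have := kH _ (ltnW kn); have := kH _ kn.
  have E2 : k.+2%:R = k%:R + 2 :> R by rewrite -addn2 natrD.
  have E1 : k.+1%:R = k%:R + 1 :> R by rewrite -addn1 natrD.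
  rewrite /f E2 E1 => H2 H1 H00 h2 h1 h00.
  have half : 0 <= (1 / 2 : R) <= 1 by lra.
  have sg : shortest_path (a + k%:R * h) (a + (k%:R + 2) * h) g.
    by apply: ge; lra.
  have := @BNPC_between _ _ A (1 / 2) (g (a + k%:R * h))
    (g (a + (k%:R + 1) * h)) (g (a + (k%:R + 2) * h)) (u (k%:R * H))
    (u ((k%:R + 1) * H)) (u ((k%:R + 2) * H)) bA half
    (Ag _ h00) (Ag _ h1) (Ag _ h2) (Au _ H00) (Au _ H1) (Au _ H2).
  rewrite 3?(shortest_path_dist _ _ _ _ _ sg); try lra.
  by rewrite 3?(shortest_path_dist _ _ _ _ _ su) -/D; lra.
have gu1 : g (a + h) = u H.
  apply: mdist_positivity; apply/eqP; rewrite eq_le mdist_ge0 andbT.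
  by have := f0 1%N isT; rewrite /f !mul1r.
have k1 := kh 1%N isT; have K1 := kH 1%N isT; rewrite mul1r in k1 K1.
have : mdist (g a) (g (a + h)) = h.
  by rewrite (shortest_path_dist _ _ _ _ _ (ge a (a + h) _ _ _ _)); lra.
rewrite -{1}u0 gu1 (shortest_path_dist _ _ _ _ _ su) -/D; try lra.
by move=> Hh; rewrite -hN -HN; nra.
Qed.

(** Among the points [z] up to which [qy] can be prolonged, with [|yz| <= T],
    compactness gives one with [|yz|] maximal. If [|yz| < T], then the shortest
    path from [q] to [z] has an extension as a geodesic that still lies in the
    ball, where it is a shortest path, contradicting maximality. Taking a
    maximum replaces the transfinite iteration of the local extension. *)
Lemma shortest_path_extend (o : X) rho T q y :
  locally_geodesically_complete X ->
  compact (mclosed_ball o rho) -> BNPC (mclosed_ball o rho) ->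
  q != y -> mclosed_ball o rho q -> 0 <= T -> mdist o y + T < rho ->
  exists w, [/\ mdist y w = T & mdist q y + mdist y w = mdist q w].
Proof.
move=> lgc cA bA qy Aq T0 oyT; have [_ gA _] := bA.
set A := mclosed_ball o rho in cA bA Aq gA.
pose Z := [set z | mdist q y + mdist y z - mdist q z = 0 /\ mdist y z <= T].
have ZA : Z `<=` A.
  move=> z [_ yz]; rewrite /A /mclosed_ball /=.
  have := metric_triangle o y z; lra.
have Zc : closed Z.
  apply: closedI; last first.
    by apply: closed_comp (@closed_le _ T) => z _; exact: mdist_continuous.
  apply: (@closed_comp _ _
    (fun z => mdist q y + mdist y z - mdist q z) [set 0]).
    move=> z _; apply: cvgB; last exact: mdist_continuous.
    by apply: cvgD; [exact: cvg_cst|exact: mdist_continuous].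
  exact: closed_eq.
have Zy : Z y by split; rewrite ?mdistxx//; lra.
have [] := @compact_EVT_max _ _ (mdist y) Z (ex_intro _ _ Zy)
  (subclosed_compact Zc cA ZA).
  exact/continuous_subspaceT/mdist_continuous.
move=> z; rewrite inE => Zz zmax; have [qyz yzT] := Zz.
have Az := ZA _ Zz; have Ay := ZA _ Zy.
exists z; split; last by lra.
apply/eqP; rewrite eq_le yzT/= leNgt; apply/negP => yzlt.
have [|g [sg Ag g0 gy gz]] := shortest_path_through _ _ _ _ gA Aq Ay Az.
  lra.
have qy0 : 0 < mdist q y by rewrite mdist_gt0.
have yz0 := mdist_ge0 y z.
set L := mdist q z in sg Ag gz qyz.
have L0 : 0 < L by lra.
have geo : geodesic 0 L g.
  exists 1 => // s t s0 st tL _; apply: shortest_pathP => //.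
    by move=> *; rewrite (shortest_path_dist _ _ _ _ _ sg); lra.
  by rewrite (shortest_path_dist _ _ _ _ _ sg).
have [e e0 [k [e' e'0 geok] kg]] := lgc _ _ _ L0 geo.
have {}kg t : 0 <= t -> t <= L -> k t = g t.
  by move=> t0 tL; apply: kg; rewrite in_itv/= t0.
pose u := Num.min e (Num.min (T - mdist y z) (e' / 2)).
have [u0 ue uT ue'] : [/\ 0 < u, u <= e, u <= T - mdist y z & u < e'].
  split; rewrite ?lt_min ?gt_min ?ge_min ?lexx ?orbT//.
    by rewrite e0/=; lra.
  by apply/orP; right; apply/orP; right; lra.
have tail t : L <= t -> t <= L + u -> mdist z (k t) = t - L.
  move=> Lt tu; rewrite -gz -(kg L) ?(ltW L0)//.
  by apply: (shortest_path_dist _ _ _ _ _ (geok L t _ _ _ _)); lra.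
have sk : shortest_path 0 (L + u) k.
  apply: (BNPC_geodesic_shortest A) => //; first lra.
    move=> t /andP[t0 tu]; have [tL|Lt] := leP t L.
      by rewrite kg//; apply: Ag; rewrite t0.
    rewrite /A /mclosed_ball/=.
    have := tail t (ltW Lt) tu; have := metric_triangle o z (k t).
    have := metric_triangle o y z; lra.
  by exists e' => // s t *; apply: geok; lra.
have ky : k (mdist q y) = y by rewrite kg//; lra.
have k0 : k 0 = q by rewrite kg//; lra.
have qk : mdist q (k (L + u)) = L + u.
  by rewrite -{1}k0 (shortest_path_dist _ _ _ _ _ sk); lra.
have yk : mdist y (k (L + u)) = mdist y z + u.
  by rewrite -{1}ky (shortest_path_dist _ _ _ _ _ sk); lra.
have : mdist y (k (L + u)) <= mdist y z by apply: zmax; rewrite inE; split; lra.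
lra.
Qed.

(** The excess [|pa| + |pb| - |ab|] is a continuous function on the compact
    set of those pairs that stay [eps]-away from every aligned pair. It does
    not vanish there, so it has a positive minimum [theta]. What matters is
    that [theta] is the same for all [a] and [b]. *)
Lemma almost_between A (p : X) (r eps : R) : compact A -> 0 < eps ->
  exists2 theta, 0 < theta & forall a b : X, A a -> A b ->
    mdist p a = r -> r <= mdist p b ->
    mdist p a + mdist p b < mdist a b + theta ->
  exists a' b' : X, [/\ A a' /\ A b', mdist p a' = r, r <= mdist p b',
    mdist p a' + mdist p b' = mdist a' b' & mdist a a' + mdist b b' < eps].
Proof.
move=> cA eps0.
pose good (a b : X) := [/\ A a, A b, mdist p a = r, r <= mdist p b &
    mdist p a + mdist p b = mdist a b].
pose f (c : X * X) := mdist p c.1 + mdist p c.2 - mdist c.1 c.2.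
have c1 : continuous (fun c : X * X => mdist p c.1).
  by move=> c; apply: mdist_cvg; [exact: cvg_cst|exact: cvg_fst].
have c2 : continuous (fun c : X * X => mdist p c.2).
  by move=> c; apply: mdist_cvg; [exact: cvg_cst|exact: cvg_snd].
have cf : continuous f.
  move=> c; apply: cvgB; first by apply: cvgD; [exact: c1|exact: c2].
  by apply: mdist_cvg; [exact: cvg_fst|exact: cvg_snd].
pose C := [set c : X * X | mdist p c.1 = r] `&`
  [set c : X * X | r <= mdist p c.2] `&`
  \bigcap_(c' in [set c' | good c'.1 c'.2])
    [set c : X * X | eps <= mdist c.1 c'.1 + mdist c.2 c'.2].
have Cc : closed C.
  apply: closedI; first apply: closedI.
  - by apply: (@closed_comp _ _ (fun c : X * X => mdist p c.1) [set r]) =>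
      [c _|]; [exact: c1|exact: closed_eq].
  - by apply: (@closed_comp _ _ (fun c : X * X => mdist p c.2)
      [set t | r <= t]) => [c _|]; [exact: c2|exact: closed_ge].
  - apply: closed_bigI => c' _.
    apply: (@closed_comp _ _
      (fun c : X * X => mdist c.1 c'.1 + mdist c.2 c'.2) [set t | eps <= t]) =>
      [c _|]; last exact: closed_ge.
    by apply: cvgD; apply: mdist_cvg;
      [exact: cvg_fst|exact: cvg_cst|exact: cvg_snd|exact: cvg_cst].
pose K := C `&` (A `*` A).
have Kc : compact K.
  rewrite /K setIC; apply: compact_closedI Cc; exact: compact_setX.
(* A pair outside of [K] is by definition close to an aligned one. *)
have out (theta : R) (a b : X) :
    (forall c, K c -> theta <= f c) -> A a -> A b ->
    mdist p a = r -> r <= mdist p b ->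
    mdist p a + mdist p b < mdist a b + theta ->
    exists a' b', good a' b' /\ mdist a a' + mdist b b' < eps.
  move=> fK Aa Ab pa pb; have [|nK] := pselect (K (a, b)).
    by move=> /fK; rewrite /f/=; lra.
  move=> _; apply: contrapT => no; apply: nK; split=> //; split=> //.
  move=> [a' b'] /= gab; rewrite leNgt; apply/negP => lt.
  by apply: no; exists a', b'.
have [theta theta0 fK] :
    exists2 theta, 0 < theta & forall c, K c -> theta <= f c.
  have [K0|/set0P/negP/negPn/eqP ->] := pselect (K !=set0); last by exists 1.
  have [|c] := compact_EVT_min K0 Kc _ (f := f).
    exact/continuous_subspaceT.
  rewrite inE => -[[[pc1 pc2] cgood] [Ac1 Ac2]] fmin.
  exists (f c); last by move=> c' Kc'; apply: fmin; rewrite inE.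
  rewrite lt_neqAle; apply/andP; split; last first.
    rewrite /f; have := metric_triangle c.1 p c.2.
    by rewrite [mdist c.1 p]metric_sym; lra.
  apply/eqP => fc0; have : eps <= mdist c.1 c.1 + mdist c.2 c.2.
    by apply: (cgood c); split=> //; rewrite /f in fc0; lra.
  by rewrite !mdistxx; lra.
exists theta => // a b Aa Ab pa pb ab.
have [a' [b' [[? ? ? ? ?] ?]]] := out theta a b fK Aa Ab pa pb ab.
by exists a', b'; split.
Qed.

End geodesics.

(** * Angles from slopes *)

Lemma acos_within_continuous (R : realType) :
  {within `[(-1), 1], continuous (@acos R)}.
Proof.
have /(_ (pi_ge0 R)) := @segment_can_ge_continuous R 0 pi cos acos.
rewrite cos0 cospi; apply; last exact: cosK.
by apply: continuous_subspaceT => x; exact: continuous_cos.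
Qed.

(** At the endpoints [acos] is continuous only from inside the interval, and
    the angles of interest are near [acos (- 1)]. *)
Lemma cvg_acos (R : realType) (T : Type) (F : set_system T) (FF : Filter F)
    (f : T -> R) (l : R) :
  -1 <= l <= 1 -> (\forall t \near F, -1 <= f t <= 1) ->
  f @ F --> l -> acos (f t) @[t --> F] --> acos l.
Proof.
move=> l1 f1 fl.
have /subspace_continuousP/(_ l) := @acos_within_continuous R.
rewrite /= in_itv => /(_ l1); apply: cvg_comp => U /= /fl.
by apply: filterS2 f1 => t ft; exact.
Qed.

Lemma acos_lt_cos (R : realType) (x d : R) : 0 < d < pi -> x <= 1 ->
  cos d < x -> acos x < d.
Proof.
move=> /andP[d0 dpi] x1 dx.
have x11 : -1 <= x <= 1 by rewrite x1 andbT (le_trans (cos_geN1 d))// ltW.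
rewrite -ltr_cos ?in_itv/= ?acosK ?in_itv//=.
- by rewrite acos_ge0// acos_lepi.
- by rewrite !ltW.
Qed.

Section angles.
Context {R : realType} {X : metricType R}.
Implicit Types (x y z m : X) (A : set X) (s t l : R).

Lemma path_from_toP A x y : geodesic_set A -> A x -> A y ->
  [/\ shortest_path 0 (mdist x y) (path_from_to x y), path_from_to x y 0 = x &
      path_from_to x y (mdist x y) = y].
Proof.
move=> gA Ax Ay; have [g [sg _ g0 g1]] := shortest_path_from0 _ _ _ gA Ax Ay.
by rewrite /path_from_to; case: xgetP => [h _ //|/(_ g)[]].
Qed.

(** First variation: the difference quotients [q] of the distance to [p] along
    the path from [y] to [a] are monotone by convexity, hence converge to some
    [m], and the law of cosines turns this into convergence of the comparison
    angles to [acos (- m)]. As [y] lies between [z] and [a], convexity also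
    bounds [q] from below by the slope between [z] and [y]. *)
Lemma angle_gt A p y z (a : X) (kappa delta : R) :
  BNPC A -> A p -> A y -> A z -> A a ->
  (forall w, mdist y w <= mdist y a -> A w) ->
  y != p -> y != a -> y != z -> mdist z y + mdist y a = mdist z a ->
  kappa * mdist y z <= mdist p y - mdist p z ->
  0 < delta < pi -> cos delta < kappa ->
  pi - delta < angle p y a.
Proof.
move=> bA Ap Ay Az Aa Aya yp ya yz zya slope dpi dk.
have [_ gA _] := bA.
have [sg g0 g1] := path_from_toP _ _ _ gA Ay Aa.
rewrite /angle; set g := path_from_to y a in sg g0 g1 *.
set L := mdist y a in sg g1 zya Aya.
have L0 : 0 < L by rewrite mdist_gt0.
pose D := mdist p y; have D0 : 0 < D by rewrite mdist_gt0 eq_sym.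
pose tau := mdist y z; have tau0 : 0 < tau by rewrite mdist_gt0.
have yg t : 0 <= t -> t <= L -> mdist y (g t) = t.
  by move=> ? ?; rewrite -{1}g0 (shortest_path_dist _ _ _ _ _ sg)// subr0.
have ga t : 0 <= t -> t <= L -> mdist (g t) a = L - t.
  by move=> ? ?; rewrite -{1}g1 (shortest_path_dist _ _ _ _ _ sg).
have Ag t : 0 <= t -> t <= L -> A (g t).
  by move=> ? ?; apply: Aya; rewrite yg.
pose q t := (mdist p (g t) - D) / t.
have gq t : 0 < t -> mdist p (g t) = D + q t * t.
  by move=> t0; rewrite /q divfK ?gt_eqF// addrC subrK.
have conv (l : R) (u v w : X) : 0 <= l <= 1 -> A u -> A v -> A w ->
    mdist u v = l * mdist u w -> mdist v w = (1 - l) * mdist u w ->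
    mdist p v <= (1 - l) * mdist p u + l * mdist p w.
  move=> l01 Au Av Aw uv vw.
  rewrite [mdist p v]metric_sym [mdist p u]metric_sym [mdist p w]metric_sym.
  by apply: (BNPC_between A l u v w p p p) => //; rewrite mdistxx mulr0.
have q_ge t : 0 < t -> t <= L -> kappa <= q t.
  move=> t0 tL.
  have zg : mdist z (g t) = tau + t.
    have := metric_triangle z y (g t); have := metric_triangle z (g t) a.
    rewrite ga ?(ltW t0)// yg ?(ltW t0)//; move: zya.
    by rewrite [mdist z y]metric_sym -/tau; lra.
  have tt : 0 < tau + t by lra.
  have := conv (tau / (tau + t)) z y (g t).
  rewrite zg divfK ?gt_eqF// [mdist z y]metric_sym -/tau yg ?(ltW t0)//.
  have e : 1 - tau / (tau + t) = t / (tau + t) by field; rewrite gt_eqF.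
  rewrite e divfK ?gt_eqF//.
  rewrite ler_pdivrMr// mul1r divr_ge0 ?(ltW tau0) ?(ltW tt)//.
  move=> /(_ _ Az Ay (Ag _ (ltW t0) tL) erefl erefl) h.
  have {}h : D <= t / (tau + t) * mdist p z + tau / (tau + t) * mdist p (g t).
    by apply: h; lra.
  have {}h : D * (tau + t) <= t * mdist p z + tau * mdist p (g t).
    rewrite -ler_pdivlMr//; apply: le_trans h _.
    by rewrite le_eqVlt; apply/orP; left; apply/eqP; field; rewrite gt_eqF.
  rewrite gq// in h; move: slope; rewrite -/tau -/D => slope.
  have : t * (tau * kappa) <= t * (tau * q t) by nra.
  by rewrite ler_pM2l// ler_pM2l.
have q_homo s t : 0 < s -> s <= t -> t <= L -> q s <= q t.
  move=> s0 st tL; have t0 : 0 < t by lra.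
  have := conv (s / t) y (g s) (g t).
  rewrite !yg ?(ltW t0) ?(ltW s0)//; try lra.
  rewrite (shortest_path_dist _ _ _ _ _ sg) ?(ltW s0)//.
  rewrite divfK ?gt_eqF// mulrBl mul1r divfK ?gt_eqF//.
  rewrite ler_pdivrMr// mul1r st divr_ge0 ?(ltW s0) ?(ltW t0)//.
  have As : A (g s) by apply: Ag; lra.
  have At : A (g t) by apply: Ag; lra.
  move=> /(_ isT Ay As At erefl erefl); rewrite -/D !gq// => h.
  have {}h : q s * s <= q t * s.
    have e : s / t * (D + q t * t) = s / t * D + s * q t.
      by field; rewrite gt_eqF.
    rewrite e in h; lra.
  by rewrite ler_pM2r in h.
pose I := Interval (BRight (0 : R)) (BRight L).
have qL : (q @` [set` I]) (q L) by exists L => //=; rewrite in_itv/= L0 lexx.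
have lbq : has_lbound (q @` [set` I]).
  by exists kappa => _ [t /= + <-]; rewrite in_itv/= => /andP[? ?]; exact: q_ge.
pose m := inf (q @` [set` I]).
have qm : q t @[t --> 0^'+] --> m.
  apply: (@nondecreasing_at_right_cvgr R q 0 (BRight L) _ _ lbq) => //.
  move=> s t; rewrite !in_itv/= => /andP[s0 sL] /andP[t0 tL] st.
  exact: q_homo.
have km : kappa <= m.
  apply: lb_le_inf; first by exists (q L).
  by move=> _ [t /= + <-]; rewrite in_itv/= => /andP[? ?]; exact: q_ge.
have q1 t : 0 < t -> t <= L -> -1 <= q t <= 1.
  move=> t0 tL; have yt := yg t (ltW t0) tL.
  have := metric_triangle p y (g t); have := metric_triangle p (g t) y.
  rewrite [mdist (g t) y]metric_sym yt -/D gq// => h1 h2.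
  have h3 : -1 * t <= q t * t by lra.
  have h4 : q t * t <= 1 * t by lra.
  by rewrite !ler_pM2r// in h3 h4; rewrite h3.
have m1 : m <= 1.
  apply: le_trans (_ : q L <= 1); last by have /andP[] := q1 L L0 (lexx _).
  exact: ge_inf.
have kN1 : -1 < kappa by apply: le_lt_trans dk; exact: cos_geN1.
pose v t := - q t + t * ((1 - q t ^+ 2) / (2 * D)).
have near0 : \forall t \near 0^'+, [/\ 0 < t, t <= L & t <= D].
  near=> t; split; near: t; [exact: nbhs_right_gt|exact: nbhs_right_le|].
  exact: nbhs_right_le.
have angE : \forall t \near 0^'+, acos (v t) = comparison_angle p y (g t).
  apply: filterS near0 => t [t0 tL tD].
  rewrite /comparison_angle /euclidean_angle yg ?(ltW t0)// -/D gq//.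
  by congr acos; rewrite /v; field; rewrite !gt_eqF.
have v1 : \forall t \near 0^'+, -1 <= v t <= 1.
  apply: filterS near0 => t [t0 tL tD]; have /andP[q0 q2] := q1 t t0 tL.
  have qq : 0 <= (1 - q t ^+ 2) / (2 * D) by rewrite divr_ge0//; nra.
  apply/andP; split; first by rewrite /v; nra.
  rewrite /v; have : t * ((1 - q t ^+ 2) / (2 * D)) <= (1 - q t ^+ 2) / 2.
    have -> : (1 - q t ^+ 2) / 2 = D * ((1 - q t ^+ 2) / (2 * D)).
      by field; rewrite gt_eqF.
    by rewrite ler_wpM2r.
  nra.
have vm : v t @[t --> 0^'+] --> - m.
  have -> : - m = - m + 0 * ((1 - m ^+ 2) / (2 * D)) by rewrite mul0r addr0.
  apply: cvgD; first exact: cvgN.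
  apply: cvgM; first exact: cvg_at_right_filter.
  apply: cvgM; last exact: cvg_cst.
  apply: cvgB; first exact: cvg_cst.
  by rewrite expr2; under eq_fun do rewrite expr2; exact: cvgM.
have Nm : -1 <= - m <= 1 by lra.
have cvg_ang := cvg_trans (near_eq_cvg angE) (cvg_acos _ _ _ _ _ _ Nm v1 vm).
rewrite (cvg_lim _ (cvg_ang _ _)); last exact: Rhausdorff.
rewrite acosN; last lra.
by rewrite ltrD2l ltrN2 acos_lt_cos//; lra.
Unshelve. all: by end_near. Qed.

End angles.

(** * Strainers near a point *)

Section strainers.
Context {R : realType} {X : metricType R}.
Implicit Types (x y z : X) (A : set X) (s t l : R).

Lemma compact_complete_set A : compact A -> complete_set A.
Proof.
move=> cA F PF FA cF; have [x [Ax clFx]] := cA F PF FA.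
exists x => //; apply/metricType_numDomainType.fcvgrPdist_lt => e e0.
have e2 : 0 < e / 2 by rewrite divr_gt0.
have [[D1 D2] [FD1 FD2] D12] := cF _ (entourage_ball X (PosNum e2)).
have [z [D1z xz]] := clFx _ _ FD1 (nbhsx_ballx x _ e2).
apply: filterS FD2 => t D2t; have /= := D12 (z, t) (conj D1z D2t).
move: xz; rewrite !ballEmdist/=; have := metric_triangle x z t; lra.
Qed.

(** Shortest paths of [A] between points of the ball stay in it, because the
    distance to its centre is convex along them. *)
Lemma BNPC_mclosed_ball A x t : BNPC A -> A x -> mclosed_ball x t `<=` A ->
  compact (mclosed_ball x t) -> BNPC (mclosed_ball x t).
Proof.
move=> bA Ax sub cC; have [_ gA cA] := bA; split.
- exact: compact_complete_set.
- move=> y z Cy Cz.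
  have [g [sg Ag g0 g1]] := shortest_path_from0 _ _ _ gA (sub _ Cy) (sub _ Cz).
  exists 0, (mdist y z), g; split=> // _ [s /= + <-].
  rewrite in_itv/= => /andP[s0 sl].
  have [yz0|yz0] := eqVneq (mdist y z) 0.
    have -> : s = 0 by lra.
    by rewrite g0.
  have yz : 0 < mdist y z by rewrite lt_neqAle eq_sym yz0 mdist_ge0.
  have ys : mdist y (g s) = s.
    by rewrite -{1}g0 (shortest_path_dist _ _ _ _ _ sg)// subr0.
  have sz : mdist (g s) z = mdist y z - s.
    by rewrite -{1}g1 (shortest_path_dist _ _ _ _ _ sg).
  have As : A (g s) by apply: Ag; rewrite s0.
  have l01 : 0 <= s / mdist y z <= 1.
    by rewrite divr_ge0 ?mdist_ge0//= ler_pdivrMr// mul1r.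
  have := BNPC_between A _ y (g s) z x x x bA l01
    (sub _ Cy) As (sub _ Cz) Ax Ax Ax.
  rewrite !mdistxx !mulr0 ys sz mulrBl mul1r divfK//.
  move=> /(_ erefl erefl erefl erefl).
  move: Cy Cz; rewrite /mclosed_ball/= [mdist (g s) x]metric_sym.
  rewrite [mdist y x]metric_sym [mdist z x]metric_sym.
  move: (s / mdist y z) l01 => l l01; nra.
- move=> g h sg Ag sh Ah; apply: cA => // u.
    by move=> /Ag /sub.
  by move=> /Ah /sub.
Qed.

Lemma BNPC_ball_exists x : locally_compact [set: X] -> locally_BNPC X ->
  exists2 r : R, 0 < r &
    compact (mclosed_ball x (10 * r)) /\ BNPC (mclosed_ball x (10 * r)).
Proof.
move=> lcX lbX; have [N nN bN] := lbX x.
have [K wK [cK _]] := lcX x I.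
have nK : nbhs x K.
  by move: wK; rewrite /within/=; apply: filterS => y; exact.
have /nbhs_ballP[e /= e0 eNK] : nbhs x (N `&` K) by exact: filterI.
exists (e / 20); first by rewrite divr_gt0.
have sub : mclosed_ball x (10 * (e / 20)) `<=` N `&` K.
  move=> y xy; apply: eNK; rewrite ballEmdist/=.
  by apply: le_lt_trans xy _; lra.
have cC : compact (mclosed_ball x (10 * (e / 20))).
  apply: subclosed_compact cK _ => [|y /sub[]//].
  exact: mclosed_ball_closed.
split=> //; apply: BNPC_mclosed_ball bN _ _ cC => [|y /sub[]//].
exact: nbhs_singleton.
Qed.

(** The path [a'w'] through [p] serves as a model for [ayw]. The error [eps]
    of its endpoints is contracted by the factor [s / r], because the points
    compared divide paths of length at least [r] in a ratio of at most
    [s / r]. The remaining error [sigma] bounds the distance of [y] from the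
    path [pa]. *)
Lemma shortest_path_passes_near A (p x y a w : X) (r s eps sigma : R) :
  BNPC A -> [/\ A p, A x, A y, A a & A w] ->
  0 < s -> s <= r -> mdist p x = s -> mdist p a = r -> mdist x a = r - s ->
  mdist x y < sigma -> y != w ->
  (exists a' w' : X, [/\ A a' /\ A w', mdist p a' = r, r <= mdist p w',
    mdist p a' + mdist p w' = mdist a' w' & mdist a a' + mdist w w' < eps]) ->
  exists z, [/\ A z, y != z, mdist y z + mdist z w = mdist y w &
    mdist p z <= sigma + eps * (s / r)].
Proof.
move=> bA [Ap Ax Ay Aa Aw] s0 sr px pa xa xy yw.
move=> [a' [w' [[Aa' Aw'] pa' pw' apw awe]]].
have [_ gA _] := bA; have r0 : 0 < r by lra.
have aa0 := mdist_ge0 a a'; have ww0 := mdist_ge0 w w'.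
(* [m] corresponds to [x] on the path from [p] to [a']. *)
have [|m [Am pm ma']] := between_exists A p a' s gA Ap Aa'; first lra.
have sr01 : 0 <= s / r <= 1.
  by rewrite divr_ge0 ?(ltW s0) ?(ltW r0)//= ler_pdivrMr// mul1r.
have xm : mdist x m <= s / r * mdist a a'.
  have := BNPC_between A _ p x a p m a' bA sr01 Ap Ax Aa Ap Am Aa'.
  rewrite px xa pa pm ma' pa' mulrBl mul1r divfK ?gt_eqF// mdistxx mulr0 add0r.
  exact.
have mw' : mdist m w' = s + mdist p w'.
  have := metric_triangle m p w'; have := metric_triangle a' m w'.
  by rewrite [mdist m p]metric_sym [mdist a' m]metric_sym; lra.
(* [p] divides the path from [m] to [w'] in the ratio [l]; [z] divides [yw]
   likewise. *)
pose l := s / (s + mdist p w'); have sw0 : 0 < s + mdist p w' by lra.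
have l0 : 0 < l by rewrite divr_gt0.
have lsr : l <= s / r.
  by rewrite /l ler_wpM2l ?(ltW s0)// lef_pV2 ?posrE//; lra.
have l01 : 0 <= l <= 1 by lra.
have yw0 : 0 < mdist y w by rewrite mdist_gt0.
have [|z [Az yz zw]] := between_exists A y w (l * mdist y w) gA Ay Aw.
  nra.
exists z; split=> //.
- by rewrite -mdist_gt0 yz mulr_gt0.
- lra.
have pz : mdist p z <= (1 - l) * mdist m y + l * mdist w' w.
  apply: (BNPC_between A l m p w' y z w) => //.
  - by rewrite mw' /l divfK ?gt_eqF// metric_sym.
  - by rewrite mw' mulrBl mul1r /l divfK ?gt_eqF//; lra.
  - by rewrite zw; lra.
have my : mdist m y <= mdist x y + mdist x m.
  by have := metric_triangle m x y; rewrite [mdist m x]metric_sym; lra.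
rewrite [mdist w' w]metric_sym in pz.
have my0 := mdist_ge0 m y.
have : (1 - l) * mdist m y <= mdist m y by nra.
have : l * mdist w w' <= s / r * mdist w w' by rewrite ler_wpM2r.
have : s / r * (mdist a a' + mdist w w') <= s / r * eps.
  by rewrite ler_wpM2l ?(ltW awe)//; have /andP[] := sr01.
lra.
Qed.

(** The point [a] opposite to [p] depends on [x] only, whereas the
    prolongation [w] beyond [y], and with it the comparison path through [p],
    is chosen for each [y] of the neighbourhood of [x]. *)
Lemma strainer_near (p : X) (r delta : R) :
  locally_geodesically_complete X -> 0 < r -> 0 < delta < pi ->
  compact (mclosed_ball p (10 * r)) -> BNPC (mclosed_ball p (10 * r)) ->
  exists2 r0 : R, 0 < r0 & forall x, 0 < mdist p x < r0 ->
    strainer1_in (ball p r) delta p x.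
Proof.
move=> lgc r0 dpi cA bA; set A := mclosed_ball p (10 * r) in cA bA.
have Ap : A p by rewrite /A /mclosed_ball/= mdistxx; lra.
have AE y : mdist p y <= 10 * r -> A y by [].
have cd1 : cos delta < 1.
  rewrite -cos0 ltr_cos ?in_itv/= ?lexx ?pi_ge0//; first by have /andP[] := dpi.
  by have /andP[/ltW -> /ltW ->] := dpi.
(* All errors are kept below multiples of [beta * s]. The slope is then at
   least [(1 - 3 * beta) / (1 + 3 * beta)], which exceeds [1 - 8 * beta]. *)
pose beta : R := (1 - cos delta) / 8.
have cdN1 := cos_geN1 delta.
have beta0 : 0 < beta by rewrite divr_gt0//; lra.
have beta1 : beta <= 1 / 4 by rewrite /beta; lra.
(* Half the radius, so that [a] lies in the tiny ball. *)
pose rho := r / 2; have rho0 : 0 < rho by rewrite /rho; lra.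
have eps0 : 0 < rho * beta by rewrite mulr_gt0.
have [theta theta0 Htheta] := almost_between A p rho (rho * beta) cA eps0.
(* [|ap| + |pw|] exceeds [|aw|] by at most [2 * |py| < 4 * s]. *)
pose r1 := Num.min (r / 8) (theta / 4).
have r10 : 0 < r1 by rewrite lt_min; apply/andP; split; lra.
exists r1 => // x /andP[px0 pxr1].
have [px8 px4] : mdist p x < r / 8 /\ mdist p x < theta / 4.
  by move: pxr1; rewrite lt_min => /andP[].
pose s := mdist p x; rewrite -/s in px0 px8 px4.
have Ax : A x by apply: AE; rewrite -/s; lra.
have px : p != x by rewrite -mdist_gt0.
have [||a [xa pxa]] :=
  shortest_path_extend p (10 * r) (rho - s) p x lgc cA bA px Ap.
- by rewrite /rho; lra.
- by rewrite -/s /rho; lra.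
have pa : mdist p a = rho by rewrite -pxa -/s xa; lra.
have Aa : A a by apply: AE; rewrite pa /rho; lra.
pose sigma := s * beta; have sigma0 : 0 < sigma by rewrite mulr_gt0.
have sigmas : sigma <= s / 4 by rewrite /sigma; nra.
split; [by rewrite ballEmdist/= mdistxx|by rewrite ballEmdist/= -/s; lra|].
exists a, (ball x sigma); split.
- by rewrite ballEmdist/= pa /rho; lra.
- exact: nbhsx_ballx.
- move=> y; rewrite !ballEmdist/=.
  by have := metric_triangle p x y; rewrite -/s; lra.
- rewrite !ballEmdist/= xa [mdist x p]metric_sym -/s /rho.
  by split=> /lt_geF/negP; apply; lra.
move=> y; rewrite ballEmdist/= => xy.
have py := metric_triangle p x y; rewrite -/s in py.
have px' := metric_triangle p y x; rewrite -/s [mdist y x]metric_sym in px'.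
have ay := metric_triangle x y a; rewrite xa in ay.
have ya := metric_triangle y x a; rewrite xa [mdist y x]metric_sym in ya.
have Ay : A y by apply: AE; lra.
have ya0 : 0 < mdist y a by rewrite /rho in ay; lra.
have ay0 : a != y by rewrite -mdist_gt0 metric_sym.
have [||w [yw ayw]] := shortest_path_extend p (10 * r) r a y lgc cA bA ay0 Aa.
- lra.
- lra.
have pyw := metric_triangle p y w.
have Aw : A w by apply: AE; lra.
have ypw := metric_triangle y p w; rewrite [mdist y p]metric_sym in ypw.
have apyw := metric_triangle a p y; rewrite [mdist a p]metric_sym in apyw.
have pay := metric_triangle p y a.
have Hclose : exists a' w' : X, [/\ A a' /\ A w', mdist p a' = rho,
    rho <= mdist p w', mdist p a' + mdist p w' = mdist a' w' &
    mdist a a' + mdist w w' < rho * beta].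
  apply: Htheta => //; first by rewrite /rho; lra.
  by rewrite -ayw [mdist a y]metric_sym; lra.
have y_w : y != w by rewrite -mdist_gt0 yw.
have srho : s <= rho by rewrite /rho; lra.
have [z [Az yz yzw pz]] :=
  shortest_path_passes_near A p x y a w rho s (rho * beta) sigma
    bA (And5 Ap Ax Ay Aa Aw) px0 srho erefl pa xa xy y_w Hclose.
have {}pz : mdist p z <= 2 * sigma.
  have e : rho * beta * (s / rho) = sigma.
    by rewrite /sigma; field; rewrite gt_eqF.
  by rewrite e in pz; lra.
have zya : mdist z y + mdist y a = mdist z a.
  have := metric_triangle a z w; have := metric_triangle a y z.
  rewrite [mdist a z]metric_sym [mdist a y]metric_sym [mdist z y]metric_sym.
  rewrite [mdist a y]metric_sym in ayw; lra.
have yz0 : 0 < mdist y z by rewrite mdist_gt0.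
have ypz := metric_triangle y p z; rewrite [mdist y p]metric_sym in ypz.
apply: (angle_gt A p y z a ((mdist p y - mdist p z) / mdist y z)) => //.
- move=> u yu; apply: AE.
  have := metric_triangle p y u; rewrite /rho in ya; lra.
- by rewrite -mdist_gt0 metric_sym; lra.
- by rewrite eq_sym.
- by rewrite divfK ?gt_eqF.
- rewrite ltr_pdivlMr//.
  have cd : cos delta = 1 - 8 * beta by rewrite /beta; lra.
  rewrite cd; rewrite /sigma in pz xy *.
  (* An upper bound on [|yz|] helps only when its coefficient is positive. *)
  have [cn|cp] := leP (1 - 8 * beta) 0.
    have : (1 - 8 * beta) * mdist y z <= 0 by nra.
    nra.
  have : (1 - 8 * beta) * mdist y z <= (1 - 8 * beta) * (s * (1 + 3 * beta)).
    by rewrite ler_pM2l//; lra.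
  nra.
Qed.

End strainers.

Theorem proposition5p5 (R : realType) :
  exists2 c : R, 0 < c &
    forall (X : metricType R), GNPC X ->
    forall (p : X) (delta : R), 0 < delta < c ->
    exists2 r0 : R, 0 < r0 &
      forall x : X, (ball p r0 `\ p) x -> strainer1 delta p x.
Proof.
exists pi; first exact: pi_gt0.
move=> X [_ lcX lgcX lbX] p delta dpi.
have [r r0 [cA bA]] := BNPC_ball_exists p lcX lbX.
have [r1 r10 strained] := strainer_near p r delta lgcX r0 dpi cA bA.
exists r1 => // x [+ xp]; rewrite ballEmdist/= => pxr1.
exists (ball p r); first by exists p, r.
apply: strained; rewrite pxr1 mdist_gt0 andbT.
by apply/eqP => px; apply: xp.
Qed.
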